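(* Let $\mathcal{A}$ be any deterministic algorithm (in the comparison-based model described in the context) that correctly constructs the convex hull of every input sequence of size $2n$ fulfilling the almost convex hull promise. Then there exists at least one input sequence of size $2n$ fulfilling the almost convex hull promise on which $\mathcal{A}$ requires $\Omega(n\log n)$ comparisons. Likewise, for any deterministic algorithm in this model that correctly constructs the Pareto front of every input sequence of size $2n$ fulfilling the almost Pareto front promise, there exists at least one such input sequence on which it requires $\Omega(n\log n)$ comparisons.
   Context: An input is a sequence $P=(p_1,p_2,\dots)$ of points in $\mathbb{R}^2$; $\mathrm{index}(p_i)=i$, and $x(p)$ is the $x$-coordinate of $p$. The convex hull of $P$ is output as its vertices in cyclic order. The Pareto front of $P$ is the sequence, ordered by $x$-coordinate, of all $p\in P$ for which no $q\in P$ has both larger $x$- and larger $y$-coordinate. $P$ fulfils the almost convex hull promise if there exists a point $p^*\in P$ such that for all convex hull vertices $p,q$ of $P$ different from $p^*$: $x(p)>x(q)\iff \mathrm{index}(p)>\mathrm{index}(q)$. The almost Pareto front promise is defined analogously with ''points of the Pareto front'' in place of ''convex hull vertices''. Model of computation. For each fixed input size, an algorithm specifies a (RAM) programme, i.e. a list of instructions. Instructions can manipulate memory, halt the programme, or make comparisons. There are two types of comparisons: (i) coordinate comparisons, comparing the $x$-coordinates or the $y$-coordinates of two input points $p_i,p_j$; (ii) orientation tests, evaluating whether an input point $p_k$ lies strictly above the line through two input points $p_i,p_j$. A comparison returns a Boolean; if true, the programme jumps to an instruction specified by the algorithm, and otherwise continues with the next instruction. Non-comparison instructions have inputs defined independently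 of the input points (coordinates cannot be manipulated). Thus the output is a combinatorial description (in terms of indices) depending only on the outcomes of the comparisons. *)

(* Defs.v *)
From mathcomp Require Import all_boot all_order all_algebra.
From mathcomp Require Import all_classical all_reals all_analysis.

Set Implicit Arguments.
Unset Strict Implicit.
Unset Printing Implicit Defensive.

Import Order.TTheory GRing.Theory Num.Theory.

Local Open Scope classical_set_scope.
Local Open Scope ring_scope.

(* R^o is R seen as a module over itself, so that points form an lmodType R. *)
Notation point R := (R^o * R^o)%type.

Definition xc (R : realType) (p : point R) : R := p.1.
Definition yc (R : realType) (p : point R) : R := p.2.

(* Indices start at 0 instead of 1; only their order matters. *)
Definition input (R : realType) (N : nat) := 'I_N -> point R.

(* A memory manipulation is an arbitrary function of the memory, so every
   concrete RAM instruction set that has no access to the coordinates is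
   covered. *)
Definition memory := nat -> nat.

Inductive comparison (N : nat) : Type :=
| CmpX of 'I_N & 'I_N
| CmpY of 'I_N & 'I_N
| Above of 'I_N & 'I_N & 'I_N.

(* The input points involved in a comparison may be addressed through the
   memory; the jump target is a constant of the programme.  What is written on
   halting is a list of indices, read off from the memory. *)
Inductive instruction (N : nat) : Type :=
| Manipulate of memory -> memory
| Halt of memory -> seq 'I_N
| Compare of (memory -> comparison N) & nat.

Definition programme (N : nat) := seq (instruction N).

Definition algorithm := forall N : nat, programme N.

(* No point is strictly above the line through p and q when that line is
   vertical or undefined (p = q). *)
Definition strictly_above (R : realType) (p q r : point R) : bool :=
  (xc p != xc q) &&
  (yc p + (yc q - yc p) / (xc q - xc p) * (xc r - xc p) < yc r).

Definition outcome (R : realType) (N : nat) (P : input R N)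
    (c : comparison N) : bool :=
  match c with
  | CmpX i j => xc (P i) < xc (P j)
  | CmpY i j => yc (P i) < yc (P j)
  | Above i j k => strictly_above (P i) (P j) (P k)
  end.

(* [exec P prog pc m k o]: on input P, from instruction number pc with memory
   m, the programme halts with output o after exactly k comparisons.  Leaving
   the list of instructions is not halting. *)
Inductive exec (R : realType) (N : nat) (P : input R N) (prog : programme N) :
    nat -> memory -> nat -> seq 'I_N -> Prop :=
| exec_halt pc m out :
    onth prog pc = Some (Halt out) ->
    exec P prog pc m 0 (out m)
| exec_manipulate pc m f k o :
    onth prog pc = Some (Manipulate N f) ->
    exec P prog pc.+1 (f m) k o ->
    exec P prog pc m k o
| exec_compare pc m c l k o :
    onth prog pc = Some (Compare c l) ->
    exec P prog (if outcome P (c m) then l else pc.+1) m k o ->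
    exec P prog pc m k.+1 o.

Definition runs (R : realType) (N : nat) (prog : programme N) (P : input R N)
    (k : nat) (o : seq 'I_N) : Prop :=
  exec P prog 0 (fun=> 0%N) k o.

Definition correct_on (R : realType) (N : nat) (prog : programme N)
    (promise : input R N -> Prop)
    (solution : input R N -> seq 'I_N -> Prop) : Prop :=
  forall P : input R N, promise P ->
    exists (k : nat) (o : seq 'I_N), runs prog P k o /\ solution P o.

Definition convex_hull (R : realType) (N : nat) (P : input R N) :
    set (point R) :=
  smallest (@convex_set R (point R)) (range P).

Definition hull_vertex (R : realType) (N : nat) (P : input R N)
    (p : point R) : Prop :=
  convex_hull P p /\
  forall (a b : point R) (t : R), convex_hull P a -> convex_hull P b ->
    0 < t < 1 -> p = t *: a + (1 - t) *: b -> a = b.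

(* Positive iff r lies to the left of the directed line from p to q. *)
Definition orient (R : realType) (p q r : point R) : R :=
  (xc q - xc p) * (yc r - yc p) - (yc q - yc p) * (xc r - xc p).

(* For two distinct vertices: they are joined by an edge of the hull, i.e. the
   whole input lies in one closed side of the line through them. *)
Definition hull_edge (R : realType) (N : nat) (P : input R N) (i j : 'I_N) :
    bool :=
  [forall k, 0 <= orient (P i) (P j) (P k)] ||
  [forall k, orient (P i) (P j) (P k) <= 0].

(* The list may start at any vertex and go round in either direction.  Every
   vertex is listed once; if it occurs several times in P, any of its indices
   may be used. *)
Definition is_convex_hull (R : realType) (N : nat) (P : input R N)
    (s : seq 'I_N) : Prop :=
  [/\ uniq (map P s),
      (forall p : point R, p \in map P s <-> hull_vertex P p)
    & cycle (hull_edge P) s].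

Definition on_front (R : realType) (N : nat) (P : input R N) (i : 'I_N) :
    bool :=
  ~~ [exists j, (xc (P i) < xc (P j)) && (yc (P i) < yc (P j))].

(* Points of the front with equal x-coordinates may be listed in any order. *)
Definition is_pareto_front (R : realType) (N : nat) (P : input R N)
    (s : seq 'I_N) : Prop :=
  [/\ uniq s,
      (forall i : 'I_N, (i \in s) = on_front P i)
    & sorted (fun i j => xc (P i) <= xc (P j)) s].

(* The exceptional point p* and the points p, q are given by their indices, so
   equal points at different positions of P count as different. *)
Definition almost_sorted (R : realType) (N : nat) (P : input R N)
    (S : 'I_N -> Prop) : Prop :=
  exists s : 'I_N, forall i j : 'I_N, S i -> S j -> i <> s -> j <> s ->
    (xc (P j) < xc (P i) <-> (j < i)%N).

Definition almost_hull_promise (R : realType) (N : nat) (P : input R N) :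
    Prop :=
  almost_sorted P (fun i => hull_vertex P (P i)).

Definition almost_front_promise (R : realType) (N : nat) (P : input R N) :
    Prop :=
  almost_sorted P (fun i => on_front P i).

(* Main.v *)
(** Place n anchors on the concave parabola y = -x^2, in the order of their
    indices, and next to each anchor one hidden point, the assignment of hidden
    points to anchors being an arbitrary permutation.  A hidden point lies on
    the segment from its anchor to a common target O (a point inside the hull,
    resp. one below and to the left of everything), so it is not part of the
    output.  Reflecting one hidden point in its anchor exposes it: the promise
    survives, with this point as the exceptional one, but the output changes.
    Because all hidden points are displaced towards the same O, this reflection
    alters only comparisons that involve both the point and its own anchor;
    hence every such pair must occur in a comparison.  Recording, for each
    comparison, its outcome and which of its operands belong together (16
    possibilities) thus determines the permutation, and n! <= 16^k. *)
Require Import Defs.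
From mathcomp Require Import all_boot all_order all_algebra all_fingroup.
From mathcomp Require Import all_classical all_reals all_analysis.
From mathcomp Require Import ring lra.

Set Implicit Arguments.
Unset Strict Implicit.
Unset Printing Implicit Defensive.

Import Order.TTheory GRing.Theory Num.Theory.
Local Open Scope ring_scope.

(** * Executions with their traces of comparisons *)

(** Keeps the resolved comparisons [c m] instead of their number, since the adversary must know
    which points have been compared. *)
Inductive traced (R : realType) (N : nat) (P : input R N) (prog : programme N) :
    nat -> memory -> seq (comparison N) -> seq 'I_N -> Prop :=
| traced_halt pc m out :
    onth prog pc = Some (Halt out) ->
    traced P prog pc m [::] (out m)
| traced_manipulate pc m f cs o :
    onth prog pc = Some (Manipulate N f) ->
    traced P prog pc.+1 (f m) cs o ->
    traced P prog pc m cs o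
| traced_compare pc m c l cs o :
    onth prog pc = Some (Compare c l) ->
    traced P prog (if outcome P (c m) then l else pc.+1) m cs o ->
    traced P prog pc m (c m :: cs) o.

Lemma exec_traced (R : realType) (N : nat) (P : input R N) (prog : programme N)
    pc m k o :
  exec P prog pc m k o ->
  exists2 cs, size cs = k & traced P prog pc m cs o.
Proof.
elim=> {pc m k o}.
- by move=> pc m out h; exists [::] => //; exact: traced_halt.
- move=> pc m f k o h _ [cs cs_k tr]; exists cs => //.
  exact: traced_manipulate h tr.
- move=> pc m c l k o h _ [cs cs_k tr]; exists (c m :: cs).
    by rewrite /= cs_k.
  exact: traced_compare h tr.
Qed.

Lemma traced_eq_outcome (R : realType) (N : nat) (P P' : input R N)
    (prog : programme N) pc m cs o :
  traced P prog pc m cs o ->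
  all (fun c => outcome P c == outcome P' c) cs ->
  traced P' prog pc m cs o.
Proof.
elim=> {pc m cs o}.
- by move=> pc m out h _; exact: traced_halt.
- by move=> pc m f cs o h _ IH /IH; exact: traced_manipulate h.
- move=> pc m c l cs o h _ IH /= /andP[/eqP e /IH].
  by rewrite e; exact: traced_compare h.
Qed.

(** Labels determine outcomes, and outcomes alone steer the control flow, so both runs pass through
    the same states. Agreement is asked only at positions inside both traces; equality of the
    lengths is a conclusion. *)
Lemma traced_eq_labels (R : realType) (N : nat) (T : Type) (d : T)
    (P P' : input R N) (L L' : comparison N -> T) (prog : programme N)
    pc m cs cs' o o' :
  (forall c, L c = L' c -> outcome P c = outcome P' c) ->
  traced P prog pc m cs o -> traced P' prog pc m cs' o' ->
  (forall i, (i < size cs)%N -> (i < size cs')%N ->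
     nth d (map L cs) i = nth d (map L' cs') i) ->
  cs = cs' /\ o = o'.
Proof.
move=> LL' tr; elim: tr cs' o' => {pc m cs o}.
- move=> pc m out h cs' o' tr' _.
  by case: tr' h => {pc m cs' o'} [pc m out'|pc m f cs' o'|pc m c l cs' o'] ->
    // [<-].
- move=> pc m f cs o h _ IH cs' o' tr' eqL.
  case: tr' h IH eqL => {pc m cs' o'}
    [pc m out'|pc m f' cs' o'|pc m c l cs' o'] -> // tr' [ff'] IH.
  by rewrite -ff' in IH *; exact: IH.
- move=> pc m c l cs o h _ IH cs' o' tr' eqL.
  case: tr' h IH eqL => {pc m cs' o'}
    [pc m out'|pc m f' cs' o'|pc m c' l' cs' o'] -> // tr' [cc' ll'] IH eqL.
  rewrite -cc' -ll' in IH eqL *.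
  have eqP := LL' _ (eqL 0%N isT isT).
  rewrite eqP in IH.
  have [i ? ?|-> ->] // := IH _ _ tr'.
  exact: (eqL i.+1).
Qed.

(** With the same input on both sides, constant labels suffice. *)
Lemma traced_deterministic (R : realType) (N : nat) (P : input R N)
    (prog : programme N) pc m cs cs' o o' :
  traced P prog pc m cs o -> traced P prog pc m cs' o' -> o = o'.
Proof.
move=> tr tr'.
by have [] // := @traced_eq_labels _ _ unit tt P P (fun=> tt) (fun=> tt)
  _ _ _ _ _ _ _ _ tr tr'; move=> i _ _; case: (nth _ _ i); case: (nth _ _ i).
Qed.

(* Padding the label sequences to a common length loses nothing: two runs with
   the same labels stay in step, hence halt together. *)
Lemma leq_card_trace_labels (R : realType) (N : nat) (I T : finType)
    (i0 : I) (d : T) (prog : programme N) (P : I -> input R N)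
    (L : I -> comparison N -> T) m
    (cs : I -> seq (comparison N)) (o : I -> seq 'I_N) :
  (forall i, traced (P i) prog 0 m (cs i) (o i)) ->
  (forall i j c, L i c = L j c -> outcome (P i) c = outcome (P j) c) ->
  (forall i j, map (L i) (cs i) = map (L j) (cs i) -> i = j) ->
  exists i, (#|I| <= #|T| ^ size (cs i))%N.
Proof.
move=> tr LP Linj.
have I_gt0 : (0 < #|I|)%N by apply/card_gt0P; exists i0.
have [i eK] := bigop.eq_bigmax (fun i : I => size (cs i)) I_gt0.
exists i; rewrite -eK; set K := \max_i _.
have leK j : (size (cs j) <= K)%N by exact: (leq_bigmax j).
pose code j : K.-tuple T := [tuple nth d (map (L j) (cs j)) k | k < K].
rewrite -card_tuple; apply: (leq_card code) => j j' eq_code.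
have eq_nth k : (k < size (cs j))%N -> (k < size (cs j'))%N ->
    nth d (map (L j) (cs j)) k = nth d (map (L j') (cs j')) k.
  move=> kj _; have kK := leq_trans kj (leK j).
  by have := congr1 (fun s => tnth s (Ordinal kK)) eq_code;
    rewrite !tnth_mktuple.
have [ecs _] := traced_eq_labels (@LP j j') (tr j) (tr j') eq_nth.
apply: Linj; apply: (@eq_from_nth _ d) => [|k]; rewrite !size_map // => kj.
by rewrite eq_nth -?ecs.
Qed.

(** * Labels of comparisons *)

Definition operands (N : nat) (c : comparison N) : seq 'I_N :=
  match c with
  | CmpX a b => [:: a; b]
  | CmpY a b => [:: a; b]
  | Above a b d => [:: a; b; d]
  end.

Definition joined (N : nat) (I : eqType) (cl : 'I_N -> I) (a b : 'I_N) : bool :=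
  (a != b) && (cl a == cl b).

(** One bit for the outcome and one for each of at most three pairs of operands. The bits tell
    whether two operands share a cluster, not which cluster it is. *)
Definition label (R : realType) (N : nat) (I : eqType) (P : input R N)
    (cl : 'I_N -> I) (c : comparison N) : bool * (bool * bool * bool) :=
  (outcome P c,
   match c with
   | CmpX a b => (joined cl a b, false, false)
   | CmpY a b => (joined cl a b, false, false)
   | Above a b d => (joined cl a b, joined cl b d, joined cl a d)
   end).

Lemma eq_label_joined (R : realType) (N : nat) (I : eqType)
    (P P' : input R N) (cl cl' : 'I_N -> I) c a b :
  label P cl c = label P' cl' c -> a \in operands c -> b \in operands c ->
  joined cl a b = joined cl' a b.
Proof.
have C (f : 'I_N -> I) x y : joined f x y = joined f y x.
  by rewrite /joined eq_sym [f x == _]eq_sym.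
have E (f : 'I_N -> I) x : joined f x x = false by rewrite /joined eqxx.
case: c => [x y|x y|x y z] [_] /=.
- move=> e; rewrite !inE => /orP[]/eqP-> /orP[]/eqP->; rewrite ?E //.
  by rewrite C e C.
- move=> e; rewrite !inE => /orP[]/eqP-> /orP[]/eqP->; rewrite ?E //.
  by rewrite C e C.
move=> e1 e2 e3; rewrite !inE => /or3P[]/eqP-> /or3P[]/eqP->; rewrite ?E //;
  by rewrite C ?e1 ?e2 ?e3 C.
Qed.

(** * Factorials, orientations and signs *)

(** Pair the factor [i + 1] with [n - i]: their product is [(n - i) + i * (n - i)], which is at
    least [n]. *)
Lemma expnn_le_fact_sq n : (n ^ n <= n`! ^ 2)%N.
Proof.
have fact_ord : n`! = \prod_(i < n) i.+1.
  by rewrite fact_prod big_add1 /= big_mkord.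
have -> : (n`! ^ 2 = \prod_(i < n) (i.+1 * (n - i)))%N.
  rewrite big_split /= -fact_ord [X in (_ * X)%N](reindex_inj rev_ord_inj) /=.
  rewrite (_ : (\prod_(j < n) _ = n`!)%N) ?mulnn //.
  by rewrite fact_ord; apply: eq_bigr => i _; rewrite /= subKn.
rewrite -[X in (_ ^ X <= _)%N](card_ord n) -prod_nat_const.
apply: leq_prod => i _; have := ltn_ord i.
move: (nat_of_ord i) => k lt_kn; rewrite mulSn.
by rewrite -{1}(subnK (ltnW lt_kn)) leq_add2l leq_pmulr // subn_gt0.
Qed.

(** Multiply by the positive square of [xc q - xc p]; on a vertical line both sides are false.
    Orientation tests thus reduce to signs of polynomials. *)
Lemma strictly_aboveE (R : realType) (p q r : R^o * R^o) :
  strictly_above p q r = (0 < (xc q - xc p) * orient p q r).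
Proof.
rewrite /strictly_above /orient.
case: eqVneq => [->|neq] /=; first by rewrite subrr mul0r ltxx.
have d0 : xc q - xc p != 0 by rewrite subr_eq0 eq_sym.
have d2 : 0 < (xc q - xc p) ^+ 2 by rewrite exprn_even_gt0.
by rewrite -[LHS]subr_gt0 -(pmulr_rgt0 _ d2); congr (0 < _); field.
Qed.

Lemma orient_cycle (R : realType) (p q r : R^o * R^o) :
  orient p q r = orient q r p.
Proof. by rewrite /orient; ring. Qed.

Lemma orient_eq0 (R : realType) (p q : R^o * R^o) :
  (orient p p q = 0) * (orient p q p = 0) * (orient q p p = 0).
Proof. by rewrite /orient; split; [split|]; ring. Qed.

(** To be applied with [y] a coordinate difference or an orientation of distinct sites, which is a
    nonzero integer. *)
Lemma eq_sgr_dist (R : realType) (x y : R) :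
  `|x - y| < 1 -> 1 <= `|y| -> Num.sg x = Num.sg y.
Proof.
rewrite ltr_distl => /andP[lo hi]; case: (lerP 0 y) => y0.
  rewrite ger0_norm // => y1; rewrite !gtr0_sg //; lra.
rewrite ltr0_norm // => y1; rewrite !ltr0_sg //; lra.
Qed.

Lemma ger1_dist_nat (R : realType) (i j : nat) :
  i != j -> 1 <= `|i%:R - j%:R : R|.
Proof.
case: (ltngtP i j) => // ij _.
  by rewrite distrC -(natrB _ (ltnW ij)) normr_nat ler1n subn_gt0.
by rewrite -(natrB _ (ltnW ij)) normr_nat ler1n subn_gt0.
Qed.

(** * Sites on the parabola and small shifts towards a common target *)

Definition site (R : realType) (i : nat) : R^o * R^o := (i%:R, - i%:R ^+ 2).

(** The anchor is at [s = 0], hidden points have [0 < s < 1], and negative [s] leads beyond the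
    anchor, away from [O]. *)
Definition toward (R : realType) (O : R^o * R^o) (s : R) (i : nat) :
    R^o * R^o :=
  (xc (site R i) + s * (xc O - xc (site R i)),
   yc (site R i) + s * (yc O - yc (site R i))).

Lemma toward0 (R : realType) (O : R^o * R^o) i : toward O 0 i = site R i.
Proof. by rewrite /toward !mul0r !addr0. Qed.

(** A Vandermonde determinant up to sign. *)
Lemma orient_site (R : realType) (i j k : nat) :
  orient (site R i) (site R j) (site R k) =
  (j%:R - i%:R) * (k%:R - i%:R) * (j%:R - k%:R).
Proof. by rewrite /orient /=; ring. Qed.

(* The sign does not depend on t < 1: two points of one cluster span a line
   through O, on one side of which [toward O t j] stays. *)
Lemma orient_toward (R : realType) (O : R^o * R^o) (s s' t : R) i j :
  orient (toward O s i) (toward O s' i) (toward O t j) =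
  (1 - t) * ((s' - s) * orient O (site R j) (site R i)).
Proof. by rewrite /orient /=; ring. Qed.

Lemma ger1_norm_mul (R : realType) (x y : R) :
  1 <= `|x| -> 1 <= `|y| -> 1 <= `|x * y|.
Proof. by move=> x1 y1; rewrite normrM mulr_ege1. Qed.

Lemma ltr_dist_mul (R : realType) (M e u u' v v' : R) :
  0 <= M -> e <= 1 -> `|u - u'| <= e -> `|v - v'| <= e -> `|u'| <= M ->
  `|v'| <= M -> `|u * v - u' * v'| <= e * (2 * M + 1).
Proof.
move=> M0 e1 eu ev u'M v'M.
have -> : u * v - u' * v' =
    (u - u') * (v - v') + (u' * (v - v') + (u - u') * v').
  by ring.
have e0 : 0 <= e by apply: le_trans eu.
have h1 : `|(u - u') * (v - v')| <= e * 1.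
  by rewrite normrM ler_pM // (le_trans ev).
have h2 : `|u' * (v - v')| <= M * e by rewrite normrM ler_pM.
have h3 : `|(u - u') * v'| <= e * M by rewrite normrM ler_pM.
apply: le_trans (ler_normD _ _) _.
apply: le_trans (lerD h1 (ler_normD _ _)) _.
by have := lerD h2 h3; lra.
Qed.

(** Uniformity in the shifts covers anchors, hidden points and reflected points at once. Only points
    at pairwise different sites are constrained. *)
Definition small (R : realType) (O : R^o * R^o) (n : nat) (t : R) : Prop :=
  [/\ 0 < t, t < 1,
      forall (i j : nat) (s s' : R), (i < n)%N -> (j < n)%N -> i != j ->
        `|s| <= t -> `|s'| <= t ->
        Num.sg (xc (toward O s j) - xc (toward O s' i)) =
          Num.sg (xc (site R j) - xc (site R i)) /\
        Num.sg (yc (toward O s j) - yc (toward O s' i)) =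
          Num.sg (yc (site R j) - yc (site R i))
    & forall (i j k : nat) (s s' s'' : R),
        (i < n)%N -> (j < n)%N -> (k < n)%N -> i != j -> i != k -> j != k ->
        `|s| <= t -> `|s'| <= t -> `|s''| <= t ->
        Num.sg (orient (toward O s i) (toward O s' j) (toward O s'' k)) =
        Num.sg (orient (site R i) (site R j) (site R k))].

Lemma ex_small (R : realType) (O : R^o * R^o) (n : nat) :
  exists t : R, small O n t.
Proof.
(* [M] bounds all coordinate differences between two sites, and between a site and [O]. *)
pose M : R := n%:R ^+ 2 + n%:R + `|xc O| + `|yc O|.
have n0 : 0 <= n%:R :> R by rewrite ler0n.
have M0 : 0 <= M by rewrite !addr_ge0 ?exprn_ge0.
(* Shifts up to [t] change a coordinate difference by at most [2 * t * M], and each of the two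
   products in [orient] by at most [2 * t * M * (2 * M + 1)]. This [t] keeps the total change below
   1 in both cases. *)
pose t : R := (8 * (M + 1) ^+ 2)^-1.
have t0 : 0 < t by rewrite invr_gt0; nra.
have tM : t * (8 * (M + 1) ^+ 2) = 1 by rewrite mulVf //; apply/eqP; nra.
have t1 : t < 1 by nra.
have site_bnd i : (i < n)%N ->
    [/\ 0 <= i%:R :> R, i%:R <= n%:R :> R & i%:R ^+ 2 <= n%:R ^+ 2 :> R].
  move=> ltin; have le_in : i%:R <= n%:R :> R by rewrite ler_nat ltnW.
  by split=> //; rewrite lerXn2r ?nnegrE.
have diff_bnd i j : (i < n)%N -> (j < n)%N ->
    `|xc (site R j) - xc (site R i)| <= M /\
    `|yc (site R j) - yc (site R i)| <= M.
  move=> /site_bnd[i0 iX iY] /site_bnd[j0 jX jY].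
  have oX := normr_ge0 (xc O); have oY := normr_ge0 (yc O).
  by rewrite !ler_norml /M /=; split; apply/andP; split; nra.
have shift_bnd i : (i < n)%N ->
    `|xc O - xc (site R i)| <= M /\ `|yc O - yc (site R i)| <= M.
  move=> /site_bnd[i0 iX iY].
  have := ler_norm (xc O); have := ler_norm (yc O).
  have := ler_norm (- xc O); have := ler_norm (- yc O); rewrite !normrN.
  have oX := normr_ge0 (xc O); have oY := normr_ge0 (yc O).
  by move=> ? ? ? ?; rewrite !ler_norml /M /=; split; apply/andP; split; nra.
have near i j s s' : (i < n)%N -> (j < n)%N -> `|s| <= t -> `|s'| <= t ->
    `|(xc (toward O s j) - xc (toward O s' i)) -
      (xc (site R j) - xc (site R i))| <= 2 * t * M /\
    `|(yc (toward O s j) - yc (toward O s' i)) -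
      (yc (site R j) - yc (site R i))| <= 2 * t * M.
  move=> /shift_bnd[iX iY] /shift_bnd[jX jY] st s't.
  have comb a b : `|a| <= M -> `|b| <= M -> `|s * a - s' * b| <= 2 * t * M.
    move=> aM bM; apply: le_trans (ler_normB _ _) _; rewrite !normrM.
    have h1 : `|s| * `|a| <= t * M by rewrite ler_pM.
    have h2 : `|s'| * `|b| <= t * M by rewrite ler_pM.
    by lra.
  split; [move: (comb _ _ jX iX)|move: (comb _ _ jY iY)];
    by congr (`|_| <= _); rewrite /toward /=; ring.
have tM_lt1 : 2 * t * M < 1 by nra.
exists t; split=> // [i j s s' lti ltj neq st s't|].
  have [nX nY] := near _ _ _ _ lti ltj st s't.
  have neq' : j != i by rewrite eq_sym.
  split; apply: eq_sgr_dist; rewrite ?(le_lt_trans nX) ?(le_lt_trans nY) //=.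
    exact: ger1_dist_nat.
  have -> : - j%:R ^+ 2 - - i%:R ^+ 2 = (i * i)%:R - (j * j)%:R :> R.
    by rewrite !natrM; ring.
  by apply: ger1_dist_nat; rewrite !mulnn eqn_sqr.
move=> i j k s s' s'' lti ltj ltk ij ik jk st s't s''t.
have [jX jY] := near _ _ _ _ lti ltj s't st.
have [kX kY] := near _ _ _ _ lti ltk s''t st.
have [djX djY] := diff_bnd _ _ lti ltj.
have [dkX dkY] := diff_bnd _ _ lti ltk.
apply: eq_sgr_dist; last first.
  by rewrite orient_site; do !apply: ger1_norm_mul => //;
     apply: ger1_dist_nat; rewrite // eq_sym.
have b1 := ltr_dist_mul M0 (ltW tM_lt1) jX kY djX dkY.
have b2 := ltr_dist_mul M0 (ltW tM_lt1) jY kX djY dkX.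
apply: (@le_lt_trans _ _ (2 * t * M * (2 * M + 1) + 2 * t * M * (2 * M + 1))).
  apply: le_trans (lerD b1 b2); apply: le_trans (ler_normB _ _).
  by rewrite le_eqVlt; apply/orP; left; apply/eqP; congr `|_|;
    rewrite /orient; ring.
by nra.
Qed.

Lemma eq_in_outcome (R : realType) (N : nat) (P P' : input R N) c :
  {in operands c, P =1 P'} -> outcome P c = outcome P' c.
Proof.
by case: c => [a b|a b|a b d] /= eqP; rewrite !eqP ?inE ?eqxx ?orbT.
Qed.

(** Only point [j] moves, and no other operand shares its cluster. Signs involving pairwise
    different clusters survive by smallness. If the other two operands of an orientation test share
    a cluster, their line passes through [O] and [j] stays on its side by [orient_toward]. *)
Lemma eq_outcome_toward (R : realType) (n N : nat) (O : R^o * R^o) (t : R)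
    (cl : 'I_N -> 'I_n) (s s' : 'I_N -> R) (j : 'I_N) (c : comparison N) :
  small O n t -> (forall a, `|s a| <= t) -> (forall a, `|s' a| <= t) ->
  (forall a, a != j -> s a = s' a) ->
  (j \in operands c -> forall a, a \in operands c -> cl a = cl j -> a = j) ->
  outcome (fun a => toward O (s a) (cl a)) c =
  outcome (fun a => toward O (s' a) (cl a)) c.
Proof.
move=> [t0 t1 smallD smallO] st s't eq_s alone.
pose P a := toward O (s a) (cl a); pose P' a := toward O (s' a) (cl a).
rewrite -/P -/P'.
have eqP a : a != j -> P a = P' a by move=> aj; rewrite /P eq_s.
have [jc|jNc] := boolP (j \in operands c); last first.
  by apply: eq_in_outcome => a ac; apply: eqP; apply: contraNneq jNc => <-.
have apart a : a \in operands c -> a != j -> (cl a != cl j :> nat).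
  by move=> ac; apply: contra_neq => /val_inj /(alone jc a ac).
have sgD a b : a \in operands c -> b \in operands c ->
    Num.sg (xc (P b) - xc (P a)) = Num.sg (xc (P' b) - xc (P' a)) /\
    Num.sg (yc (P b) - yc (P a)) = Num.sg (yc (P' b) - yc (P' a)).
  move=> ac bc; have [->|aj] := eqVneq a j; have [->|bj] := eqVneq b j.
  - by rewrite !subrr.
  - have neq := apart _ bc bj; rewrite eq_sym in neq.
    have [] := smallD _ _ _ _ (ltn_ord _) (ltn_ord _) neq (st b) (st j).
    have [] := smallD _ _ _ _ (ltn_ord _) (ltn_ord _) neq (s't b) (s't j).
    by move=> -> -> -> ->.
  - have neq := apart _ ac aj.
    have [] := smallD _ _ _ _ (ltn_ord _) (ltn_ord _) neq (st j) (st a).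
    have [] := smallD _ _ _ _ (ltn_ord _) (ltn_ord _) neq (s't j) (s't a).
    by move=> -> -> -> ->.
  - by rewrite !eqP.
have sgO3 a b : a \in operands c -> b \in operands c -> a != j -> b != j ->
    Num.sg (orient (P a) (P b) (P j)) = Num.sg (orient (P' a) (P' b) (P' j)).
  move=> ac bc aj bj; rewrite -(eqP _ aj) -(eqP _ bj).
  have [clab|clab] := eqVneq (cl a) (cl b).
    rewrite /P /P' clab !orient_toward ![Num.sg ((1 - _) * _)]sgrM.
    have pos r : `|r| <= t -> 0 < 1 - r.
      move=> rt; rewrite subr_gt0 (le_lt_trans (ler_norm _)) //.
      by rewrite (le_lt_trans rt).
    by rewrite !(gtr0_sg (pos _ _)).
  have ab : (cl a != cl b :> nat) by [].
  have [aj' bj'] := (apart _ ac aj, apart _ bc bj).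
  by rewrite /P /P' !smallO // ltn_ord.
(* The orientation vanishes if [j] occurs twice; if it occurs once, a cyclic rotation puts it last,
   as [sgO3] requires. *)
have sgO a b d : a \in operands c -> b \in operands c -> d \in operands c ->
    Num.sg (orient (P a) (P b) (P d)) = Num.sg (orient (P' a) (P' b) (P' d)).
  move=> ac bc dc; have [->|aj] := eqVneq a j; have [->|bj] := eqVneq b j;
    have [->|dj] := eqVneq d j; rewrite ?orient_eq0 //.
  - by rewrite orient_cycle [in RHS]orient_cycle sgO3.
  - by rewrite -orient_cycle -[in RHS]orient_cycle sgO3.
  - by rewrite sgO3.
  - by rewrite !eqP.
case: c sgD sgO {alone jc apart sgO3} => [a b|a b|a b d] sgD sgO;
  rewrite /outcome.
- have [||sX _] := sgD a b; rewrite ?inE ?eqxx ?orbT //.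
  by rewrite -!(subr_gt0 (xc _)) -sgr_gt0 sX ?sgr_gt0.
- have [||_ sY] := sgD a b; rewrite ?inE ?eqxx ?orbT //.
  by rewrite -!(subr_gt0 (yc _)) -sgr_gt0 sY ?sgr_gt0.
have [||sX _] := sgD a b; rewrite ?inE ?eqxx ?orbT //.
rewrite !strictly_aboveE -sgr_gt0 sgrM sX sgO ?inE ?eqxx ?orbT //.
by rewrite -sgrM sgr_gt0.
Qed.

(** * Configurations of anchors and hidden points, and the counting argument *)

Lemma twiceE n : (2 * n = n + n)%N.
Proof. by rewrite mul2n addnn. Qed.

Definition half n (a : 'I_(2 * n)) : 'I_n + 'I_n :=
  fintype.split (cast_ord (twiceE n) a).

(* Anchors have the indices 0, ..., n-1 and hidden points n, ..., 2n-1. *)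
Definition lo n (i : 'I_n) : 'I_(2 * n) :=
  cast_ord (esym (twiceE n)) (lshift n i).

Definition hi n (i : 'I_n) : 'I_(2 * n) :=
  cast_ord (esym (twiceE n)) (rshift n i).

Lemma half_lo n (i : 'I_n) : half (lo i) = inl i.
Proof. by rewrite /half cast_ordKV (unsplitK (inl _)). Qed.

Lemma half_hi n (i : 'I_n) : half (hi i) = inr i.
Proof. by rewrite /half cast_ordKV (unsplitK (inr _)). Qed.

Variant half_spec n (a : 'I_(2 * n)) : Type :=
| HalfLo i of a = lo i
| HalfHi i of a = hi i.

Lemma halfP n (a : 'I_(2 * n)) : half_spec a.
Proof.
case: (split_ordP (cast_ord (twiceE n) a)) => i e.
  by apply: (@HalfLo _ _ i); rewrite /lo -e cast_ordK.
by apply: (@HalfHi _ _ i); rewrite /hi -e cast_ordK.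
Qed.

Lemma lo_neq_hi n (i j : 'I_n) : lo i != hi j.
Proof. by apply/eqP => /(congr1 (@half n)); rewrite half_lo half_hi. Qed.

Lemma hi_inj n : injective (@hi n).
Proof. by move=> i j /(congr1 (@half n)); rewrite !half_hi => -[]. Qed.

Definition cluster n (pi : {perm 'I_n}) (a : 'I_(2 * n)) : 'I_n :=
  match half a with inl i => i | inr j => pi j end.

Definition shift (R : realType) n (s : 'I_n -> R) (a : 'I_(2 * n)) : R :=
  match half a with inl _ => 0 | inr j => s j end.

Definition config (R : realType) n (O : R^o * R^o) (pi : {perm 'I_n})
    (s : 'I_n -> R) : input R (2 * n) :=
  fun a => toward O (shift s a) (cluster pi a).

Lemma config_lo (R : realType) n (O : R^o * R^o) (pi : {perm 'I_n}) s i :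
  config O pi s (lo i) = site R i.
Proof. by rewrite /config /shift /cluster half_lo toward0. Qed.

Lemma config_hi (R : realType) n (O : R^o * R^o) (pi : {perm 'I_n}) s j :
  config O pi s (hi j) = toward O (s j) (pi j).
Proof. by rewrite /config /shift /cluster half_hi. Qed.

Definition exposed (R : realType) n (t : R) (j : 'I_n) : 'I_n -> R :=
  fun k => if k == j then - t else t.

Lemma cluster_eq n (pi : {perm 'I_n}) (a : 'I_(2 * n)) j :
  cluster pi a = pi j -> a = lo (pi j) \/ a = hi j.
Proof.
case: (halfP a) => i ->; rewrite /cluster ?half_lo ?half_hi;
  [by move=> ->; left|by move=> /perm_inj ->; right].
Qed.

Lemma has_map_eq (S T : Type) (f g : S -> T) (p : pred S) s :
  map f s = map g s -> has p s -> exists2 c, p c & f c = g c.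
Proof.
elim: s => //= c s IH [fg fgs] /orP[pc|]; first by exists c.
exact: IH.
Qed.

(** Common core of both bounds; [O], the promise and the solution are all that differ. *)
Lemma comparisons_ge_fact (R : realType) (n : nat) (O : R^o * R^o) (t : R)
    (promise : input R (2 * n) -> Prop)
    (solution : input R (2 * n) -> seq 'I_(2 * n) -> Prop)
    (prog : programme (2 * n)) :
  small O n t ->
  (forall (pi : {perm 'I_n}), promise (config O pi (fun=> t))) ->
  (forall (pi : {perm 'I_n}) j, promise (config O pi (exposed t j))) ->
  (forall (pi : {perm 'I_n}) j o, solution (config O pi (fun=> t)) o ->
     ~ solution (config O pi (exposed t j)) o) ->
  correct_on prog promise solution ->
  exists P, promise P /\ exists k o, runs prog P k o /\ (n`! <= 16 ^ k)%N.
Proof.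
move=> t_small hid exp sol correct.
have [t0 t1 _ _] := t_small.
pose X pi : input R (2 * n) := config O pi (fun=> t).
have /boolp.choice[f fP] (pi : {perm 'I_n}) : exists cso,
    [/\ runs prog (X pi) (size cso.1) cso.2,
        traced (X pi) prog 0 (fun=> 0%N) cso.1 cso.2 &
        solution (X pi) cso.2].
  have [k [out [run so]]] := correct _ (hid pi).
  by have [cs csk tr] := exec_traced run; exists (cs, out); rewrite /= csk.
pose meets (pi : {perm 'I_n}) j c :=
  (lo (pi j) \in operands c) && (hi j \in operands c).
(* Otherwise exposing [hi j] would change no outcome on the trace, and the same output would have to
   solve both inputs. *)
have meet pi j : has (meets pi j) (f pi).1.
  apply: contraT; rewrite -all_predC => noMeet.
  have [_ tr so] := fP pi.
  have tr' : traced (config O pi (exposed t j)) prog 0 (fun=> 0%N)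
      (f pi).1 (f pi).2.
    apply: traced_eq_outcome tr _; apply: sub_all noMeet => c noMeet; apply/eqP.
    have tt : `|t| <= t by rewrite gtr0_norm.
    apply: (@eq_outcome_toward _ _ _ _ _ (cluster pi) _ _ (hi j) _ t_small).
    - by move=> a; rewrite /shift; case: half => _ //; rewrite normr0 ltW.
    - move=> a; rewrite /shift /exposed; case: half => [_|k].
        by rewrite normr0 ltW.
      by case: ifP; rewrite ?normrN.
    - move=> a; case: (halfP a) => k ->; rewrite /shift ?half_lo ?half_hi //.
      by rewrite (inj_eq (@hi_inj n)) /exposed => /negPf->.
    move=> hic a ac; rewrite {2}/cluster half_hi => /cluster_eq[] // ea.
    by move: noMeet; rewrite /= /meets hic -ea ac.
  have [k [out [run' so']]] := correct _ (exp pi j).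
  have [cs' _ tr''] := exec_traced run'.
  by case: (sol pi j _ so); rewrite (traced_deterministic tr' tr'').
have [pi] : exists pi : {perm 'I_n}, (#|{perm 'I_n}| <=
    #|{: bool * (bool * bool * bool)}| ^ size (f pi).1)%N.
  apply: (@leq_card_trace_labels _ _ _ _ 1%g (false, (false, false, false)) prog
    X (fun pi => label (X pi) (cluster pi)) _ _ (fun pi => (f pi).2)).
  - by move=> pi; have [_ tr _] := fP pi; exact: tr.
  - by move=> pi pi' c [].
  move=> pi pi' eqL; apply/permP => j.
  (* At this comparison [hi j] meets its anchor [lo (pi j)]; equal labels mean that [pi'] joins them
     too, so [pi' j = pi j]. *)
  have [c /andP[qc rc] eqc] := has_map_eq eqL (meet pi j).
  have := eq_label_joined eqc qc rc.
  rewrite /joined lo_neq_hi /cluster !half_lo !half_hi eqxx /=.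
  by move=> /esym/eqP.
rewrite card_Sn !card_prod card_bool => le_fact.
have [run _ _] := fP pi.
by exists (X pi); split; [exact: hid|exists (size (f pi).1), (f pi).2].
Qed.

(** * The convex hull bound *)

Lemma convex_combine (R : realType) (A : set (R^o * R^o)) a b (t : R) :
  convex_set A -> A a -> A b -> 0 < t < 1 -> A (t *: a + (1 - t) *: b).
Proof.
move=> cA /mem_set Aa /mem_set Ab /andP[t0 t1].
have := cA a b (Itv01 (ltW t0) (ltW t1)) Aa Ab.
by rewrite inE.
Qed.

Lemma combine_convex (R : realType) (A : set (R^o * R^o)) :
  (forall a b (t : R), A a -> A b -> 0 < t < 1 -> A (t *: a + (1 - t) *: b)) ->
  convex_set A.
Proof.
move=> cA; apply/convex_setW => a b /set_mem Aa /set_mem Ab k k0 k1.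
by rewrite inE; apply: cA; rewrite ?k0.
Qed.

Lemma combineE (R : realType) (a b : R^o * R^o) (t : R) :
  t *: a + (1 - t) *: b =
  (t * xc a + (1 - t) * xc b, t * yc a + (1 - t) * yc b).
Proof. by []. Qed.

Lemma hull_input (R : realType) (N : nat) (P : input R N) i :
  convex_hull P (P i).
Proof. by apply: sub_gen_smallest; exists i. Qed.

Lemma hull_combine (R : realType) (N : nat) (P : input R N) a b (t : R) :
  convex_hull P a -> convex_hull P b -> 0 < t < 1 ->
  convex_hull P (t *: a + (1 - t) *: b).
Proof.
move=> ha hb t01 A [cA PA].
by apply: convex_combine => //; [apply: ha|apply: hb].
Qed.

(** [P j] together with the half-plane where [f] is smaller than [f (P j)] forms a convex set
    containing the input, hence the hull. A proper combination equal to [P j] must then have both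
    ends at [P j]. *)
Lemma hull_vertex_of_max (R : realType) (N : nat) (P : input R N) j (u v : R) :
  let f (p : R^o * R^o) := u * xc p + v * yc p in
  (forall i, i != j -> f (P i) < f (P j)) -> hull_vertex P (P j).
Proof.
move=> f max_j; split; first exact: hull_input.
have fE a b (t : R) : f (t *: a + (1 - t) *: b) = t * f a + (1 - t) * f b.
  by rewrite combineE /f /=; ring.
have sub p : convex_hull P p -> p = P j \/ f p < f (P j).
  move: p; apply: smallest_sub => [|_ [i _ <-]]; last first.
    by have [->|/max_j] := eqVneq i j; [left|right].
  apply: combine_convex => a b t /= ha hb /andP[t0 t1].
  case: ha hb => [->|fa] [->|fb].
  - by left; rewrite -scalerDl addrC subrK scale1r.
  - by right; rewrite fE; nra.
  - by right; rewrite fE; nra.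
  - by right; rewrite fE; nra.
move=> a b t /sub ha /sub hb /andP[t0 t1] /(congr1 f); rewrite fE.
by case: ha hb => [->|fa] [->|fb] // e; exfalso; nra.
Qed.

(** Anchors have their index as [x]-coordinate, so once [hi j] is taken as the exceptional point
    nothing is out of order. *)
Lemma almost_sorted_config (R : realType) n (O : R^o * R^o)
    (pi : {perm 'I_n}) (s : 'I_n -> R) j (S : 'I_(2 * n) -> Prop) :
  (forall k, k != j -> ~ S (hi k)) -> almost_sorted (config O pi s) S.
Proof.
move=> hidden; exists (hi j) => a b.
case: (halfP a) => i ->; last first.
  by have [->|/hidden] := eqVneq i j.
case: (halfP b) => k ->; last first.
  by have [->|/hidden] := eqVneq k j.
by rewrite !config_lo /= ltr_nat.
Qed.

(** The midpoint of sites 0 and 1: it lies in the hull as soon as [n] is at least 2, and its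
    non-integral [x]-coordinate separates it from every site. *)
Definition inner (R : realType) : R^o * R^o := (2^-1, - 2^-1).

Lemma inner_in_hull (R : realType) n (O : R^o * R^o) (pi : {perm 'I_n}) s :
  (1 < n)%N -> convex_hull (config O pi s) (inner R).
Proof.
move=> n_gt1; have n_gt0 := ltnW n_gt1.
have h0 := @hull_input _ _ (config O pi s) (lo (Ordinal n_gt0)).
have h1 := @hull_input _ _ (config O pi s) (lo (Ordinal n_gt1)).
rewrite !config_lo in h0 h1.
have half01 : 0 < (2^-1 : R) < 1 by apply/andP; split; lra.
have := @hull_combine _ _ _ _ _ _ h0 h1 half01.
congr (convex_hull _ _).
by rewrite combineE /inner /=; congr pair; field.
Qed.

Lemma hidden_not_vertex (R : realType) n (pi : {perm 'I_n}) (s : 'I_n -> R) j :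
  (1 < n)%N -> 0 < s j < 1 ->
  ~ hull_vertex (config (inner R) pi s) (config (inner R) pi s (hi j)).
Proof.
move=> n_gt1 s01 [_ /(_ (inner R) (site R (pi j)) (s j))].
have hq := @hull_input _ _ (config (inner R) pi s) (lo (pi j)).
rewrite config_lo in hq.
move=> /(_ (@inner_in_hull _ _ _ _ _ n_gt1) hq s01) ext.
have /(congr1 (@xc R)) /= : inner R = site R (pi j).
  apply: ext; rewrite config_hi combineE /toward.
  by congr pair; ring.
have [->|neq] := eqVneq (nat_of_ord (pi j)) 0%N; first by lra.
have : 1 <= (pi j)%:R :> R by rewrite ler1n lt0n.
by lra.
Qed.

(* f is constant along the tangent to the parabola at site (pi j). *)
Lemma exposed_vertex (R : realType) n (pi : {perm 'I_n}) (t : R) j i :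
  let P := config (inner R) pi (exposed t j) in
  let f (p : R^o * R^o) := 2 * (pi j)%:R * xc p + 1 * yc p in
  0 < t < 1 -> i != hi j -> f (P i) < f (P (hi j)).
Proof.
move=> P f /andP[t0 t1].
set q : R := (pi j)%:R.
have fsite k : f (site R k) = q ^+ 2 - (q - k%:R) ^+ 2.
  by rewrite /f /=; ring.
have ftow s k :
    f (toward (inner R) s k) = f (site R k) + s * (f (inner R) - f (site R k)).
  by rewrite /f /=; ring.
have q0 : 0 <= q by [].
have finner : f (inner R) < q ^+ 2.
  have -> : f (inner R) = q ^+ 2 - (q - 2^-1) ^+ 2 - 4^-1.
    by rewrite /f /=; field.
  by nra.
(* From [inner] to the site [f] increases to [q ^+ 2], so it exceeds this value beyond the site. *)
have fj : q ^+ 2 < f (P (hi j)).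
  rewrite /P config_hi ftow fsite /exposed eqxx subrr expr0n subr0.
  by nra.
have fle k : f (site R k) <= q ^+ 2 by rewrite fsite gerBl sqr_ge0.
case: (halfP i) => k ->.
  by move=> _; rewrite /P config_lo; apply: le_lt_trans fj.
rewrite (inj_eq (@hi_inj n)) => kj; apply: lt_trans fj.
rewrite /P config_hi ftow /exposed (negPf kj).
have := fle (pi k); nra.
Qed.

Lemma hull_comparisons (R : realType) (n : nat) (prog : programme (2 * n)) :
  (1 < n)%N ->
  correct_on prog (@almost_hull_promise R (2 * n))
    (@is_convex_hull R (2 * n)) ->
  exists P : input R (2 * n), almost_hull_promise P /\
    exists k o, runs prog P k o /\ (n`! <= 16 ^ k)%N.
Proof.
move=> n_gt1; have [t t_small] := ex_small (inner R) n.
have [t0 t1 _ _] := t_small.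
have t01 : 0 < t < 1 by rewrite t0.
apply: (comparisons_ge_fact t_small) => [pi|pi j|pi j o].
- apply: (@almost_sorted_config _ _ _ _ _ (Ordinal n_gt1)) => k _.
  exact: hidden_not_vertex.
- apply: (@almost_sorted_config _ _ _ _ _ j) => k kj.
  by apply: hidden_not_vertex => //; rewrite /exposed (negPf kj).
move=> [_ vtx _] [_ vtx' _].
have /vtx'/mapP[l lo Pl] :
    hull_vertex (config (inner R) pi (exposed t j))
      (config (inner R) pi (exposed t j) (hi j)).
  by apply: hull_vertex_of_max => i; exact: exposed_vertex.
(* The output may name a vertex by any of its indices; strictness of the maximum rules out every
   index but [hi j]. *)
have lj : l = hi j.
  apply: contraTeq isT => /(@exposed_vertex R n pi t j _ t01).
  by rewrite -Pl ltxx.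
apply: (@hidden_not_vertex R n pi (fun=> t) j) => //.
by apply/vtx; rewrite map_f // -lj.
Qed.

(** * The Pareto front bound *)

(** Strictly left of and below all sites of index less than [n]: a hidden point is dominated by its
    anchor, a reflected one dominates it. *)
Definition below (R : realType) (n : nat) : R^o * R^o := (-1, - n%:R ^+ 2).

Lemma hidden_not_front (R : realType) n (pi : {perm 'I_n}) (s : 'I_n -> R) j :
  0 < s j -> on_front (config (below R n) pi s) (hi j) = false.
Proof.
move=> s0; apply/negbF/existsP; exists (lo (pi j)).
rewrite config_lo config_hi /=.
have i0 : 0 <= (pi j)%:R :> R by [].
have iN : (pi j)%:R ^+ 2 < n%:R ^+ 2 :> R by rewrite ltrXn2r // ltr_nat.
by apply/andP; split; nra.
Qed.

(** A point dominating [hi j] would also dominate the anchor of [hi j], and so would the site of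
    that point. But no site dominates another, as [y] decreases along the parabola. *)
Lemma exposed_front (R : realType) n (pi : {perm 'I_n}) (t : R) j :
  0 < t -> on_front (config (below R n) pi (exposed t j)) (hi j).
Proof.
move=> t0; apply/existsPn => a; apply/negP => /andP[].
set P := config _ _ _.
have i0 k : 0 <= (pi k)%:R :> R by [].
have iN k : (pi k)%:R ^+ 2 < n%:R ^+ 2 :> R by rewrite ltrXn2r // ltr_nat.
have noDom (k : 'I_n) : (pi j)%:R < k%:R :> R ->
    - (pi j)%:R ^+ 2 < - k%:R ^+ 2 :> R -> False.
  by move=> jk; have := i0 j; nra.
have jX : (pi j)%:R < xc (P (hi j)).
  by rewrite /P config_hi /exposed eqxx /=; have := i0 j; nra.
have jY : - (pi j)%:R ^+ 2 < yc (P (hi j)).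
  by rewrite /P config_hi /exposed eqxx /=; have := iN j; nra.
case: (halfP a) => k ->.
  rewrite {2 4}/P config_lo => /(lt_trans jX) hx /(lt_trans jY).
  exact: noDom.
have [->|kj] := eqVneq k j; first by rewrite ltxx.
rewrite {2 4}/P config_hi /exposed (negPf kj) /=.
move=> /(lt_trans jX) hx /(lt_trans jY) hy; apply: (noDom (pi k)).
  by have := i0 k; nra.
by have := i0 k; have := iN k; nra.
Qed.

Lemma front_comparisons (R : realType) (n : nat) (prog : programme (2 * n)) :
  (1 < n)%N ->
  correct_on prog (@almost_front_promise R (2 * n))
    (@is_pareto_front R (2 * n)) ->
  exists P : input R (2 * n), almost_front_promise P /\
    exists k o, runs prog P k o /\ (n`! <= 16 ^ k)%N.
Proof.
move=> n_gt1; have [t t_small] := ex_small (below R n) n.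
have [t0 t1 _ _] := t_small.
apply: (comparisons_ge_fact t_small) => [pi|pi j|pi j o].
- apply: (@almost_sorted_config _ _ _ _ _ (Ordinal n_gt1)) => k _.
  by rewrite hidden_not_front.
- apply: (@almost_sorted_config _ _ _ _ _ j) => k kj.
  by rewrite hidden_not_front // /exposed (negPf kj).
move=> [_ front _] [_ front' _].
by have := front (hi j); rewrite front' exposed_front // hidden_not_front.
Qed.

(** * From factorials to [n ln n] *)

Lemma nlnn_le (R : realType) (b n k : nat) :
  (1 < b)%N -> (1 < n)%N -> (n`! <= b ^ k)%N ->
  (2 * ln (b%:R : R))^-1 * (n%:R * ln n%:R) <= k%:R.
Proof.
move=> b_gt1 n_gt1 le_fact.
have lnb_gt0 : 0 < ln (b%:R : R) by rewrite ln_gt0 // ltr1n.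
rewrite mulrC ler_pdivrMr ?mulr_gt0 //.
have n_gt0 : 0 < n%:R :> R by rewrite ltr0n ltnW.
have b_gt0 : 0 < b%:R :> R by rewrite ltr0n ltnW.
have : (n ^ n <= (b ^ k) ^ 2)%N.
  by apply: leq_trans (expnn_le_fact_sq n) _; rewrite leq_exp2r.
rewrite -expnM -(ler_nat R) !natrX -ler_ln ?posrE ?exprn_gt0 //.
rewrite !lnXn // -[ln _ *+ n]mulr_natl -[ln _ *+ _]mulr_natl natrM.
by rewrite mulrA.
Qed.

Theorem theorem11 (R : realType) :
  (exists (c : R) (n0 : nat), 0 < c /\
     forall (A : algorithm) (n : nat), (n0 <= n)%N ->
       correct_on (A (2 * n)%N) (@almost_hull_promise R (2 * n)%N)
         (@is_convex_hull R (2 * n)%N) ->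
       exists P : input R (2 * n)%N, almost_hull_promise P /\
         exists (k : nat) (o : seq 'I_(2 * n)%N),
           runs (A (2 * n)%N) P k o /\ c * (n%:R * ln n%:R) <= k%:R)
  /\
  (exists (c : R) (n0 : nat), 0 < c /\
     forall (A : algorithm) (n : nat), (n0 <= n)%N ->
       correct_on (A (2 * n)%N) (@almost_front_promise R (2 * n)%N)
         (@is_pareto_front R (2 * n)%N) ->
       exists P : input R (2 * n)%N, almost_front_promise P /\
         exists (k : nat) (o : seq 'I_(2 * n)%N),
           runs (A (2 * n)%N) P k o /\ c * (n%:R * ln n%:R) <= k%:R).
Proof.
have c_gt0 : 0 < (2 * ln (16%:R : R))^-1.
  by rewrite invr_gt0 mulr_gt0 // ln_gt0 // ltr1n.
(* The base 16 is the number of labels; the threshold 2 provides the two sites that define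
   [inner]. *)
split; exists (2 * ln 16%:R)^-1, 2%N; split=> // A n n_gt1.
  move=> /(hull_comparisons n_gt1)[P [PP [k [out [run le_fact]]]]].
  by exists P; split=> //; exists k, out; split=> //; exact: nlnn_le.
move=> /(front_comparisons n_gt1)[P [PP [k [out [run le_fact]]]]].
by exists P; split=> //; exists k, out; split=> //; exact: nlnn_le.
Qed.
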